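(* For each $N\in\mathbb{N}$, $N\geq2$, there exists a compact and countable set $E\subset\mathbb{R}^N$ with exactly one accumulation point such that for any $m\in\{1,\dots,N-1\}$ and any $s\in[1,N/m)$, the set $E$ is not contained in a $(1/s)$-Hölder image of $[0,1]^m$; that is, there is no map $f:[0,1]^m\to\mathbb{R}^N$ and finite constant $H$ with $|f(x)-f(y)|\leq H|x-y|^{1/s}$ for all $x,y\in[0,1]^m$ and $E\subset f([0,1]^m)$.
   Context: All notions are standard; $|\cdot|$ is the Euclidean norm. *)

(* Defs.v *)
From HB Require Import structures.
From mathcomp Require Import all_boot all_order all_algebra.
From mathcomp Require Import all_classical all_reals all_analysis.

Set Implicit Arguments.
Unset Strict Implicit.
Unset Printing Implicit Defensive.

Import Order.TTheory GRing.Theory Num.Theory.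
Import numFieldNormedType.Exports.

Local Open Scope classical_set_scope.
Local Open Scope ring_scope.

(* The library norm `|x| on 'rV[R]_n is the sup norm, hence this separate
   Euclidean norm. Both induce the product topology carried by 'rV[R]_n. *)
Definition eucl_norm (R : realType) (n : nat) (x : 'rV[R]_n) : R :=
  Num.sqrt (\sum_(i < n) x 0 i ^+ 2).

Definition unit_cube (R : realType) (m : nat) : set 'rV[R]_m :=
  [set x | forall i : 'I_m, 0 <= x 0 i <= 1].

(* Only the values of f on A are constrained, so a total f stands for a map
   defined on A. *)
Definition holder_on (R : realType) (m n : nat) (A : set 'rV[R]_m) (a : R)
    (f : 'rV[R]_m -> 'rV[R]_n) : Prop :=
  exists H : R, forall x y : 'rV[R]_m, A x -> A y ->
    eucl_norm (f x - f y) <= H * eucl_norm (x - y) `^ a.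

(* Main.v *)
Require Import Defs.
From HB Require Import structures.
From mathcomp Require Import all_boot all_order all_algebra.
From mathcomp Require Import all_classical all_reals all_analysis.
From mathcomp Require Import lra.

(** The set is the union over [k] of grids of [2 ^ (k ^ 2 * N)] points with
    spacing [2 ^- (k ^ 2 + k)], each contained in the box of radius [2 ^- k]
    around the origin. All but finitely many of its points lie in any given
    neighbourhood of the origin, so it is countable and compact, and the origin
    is its only accumulation point.

    The number of points of a grid is superpolynomial in the inverse of its
    size, so at the scale of its spacing it looks [N]-dimensional. A
    [1 / s]-Hölder image of the [m]-cube contains at most about [d `^ (- s * m)]
    points at mutual distance [d] ([holder_separated_card]): cutting the cube
    into cells of side about [d `^ s], two points of a cell have images at
    distance less than [d]. For [d = 2 ^- (k ^ 2 + k)] this allows only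
    [2 `^ (s * m * k ^ 2 + O(k))] points, and since [s * m < N] the grid has more
    for large [k] ([grid_not_in_holder_image]). *)

Set Implicit Arguments.
Unset Strict Implicit.
Unset Printing Implicit Defensive.

Import Order.TTheory GRing.Theory Num.Theory.
Import numFieldNormedType.Exports.

Local Open Scope classical_set_scope.
Local Open Scope ring_scope.

(** * Euclidean norm and coordinates *)

Lemma le_coord_eucl_norm (R : realType) (n : nat) (x : 'rV[R]_n) (i : 'I_n) :
  `|x 0 i| <= eucl_norm x.
Proof.
rewrite /eucl_norm -sqrtr_sqr ler_wsqrtr// (bigD1 i)//= lerDl.
by apply: sumr_ge0 => j _; rewrite sqr_ge0.
Qed.

(** The factor [n] instead of the optimal [Num.sqrt n] only affects
    constants. *)
Lemma eucl_norm_le (R : realType) (n : nat) (x : 'rV[R]_n) (c : R) :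
  (forall i, `|x 0 i| <= c) -> eucl_norm x <= n%:R * c.
Proof.
case: n x => [|n] x xc; first by rewrite /eucl_norm big_ord0 sqrtr0 mul0r.
have c0 : 0 <= c by apply: le_trans (xc 0); exact: normr_ge0.
rewrite -(ger0_norm (mulr_ge0 (ler0n _ _) c0)) -sqrtr_sqr ler_wsqrtr//.
apply: (@le_trans _ _ (\sum_(i < n.+1) c ^+ 2)).
  by apply: ler_sum => i _; rewrite -real_normK ?num_real// ler_sqr ?nnegrE.
rewrite sumr_const card_ord -[leLHS]mulr_natl exprMn.
apply: ler_wpM2r; first exact: sqr_ge0.
by rewrite -natrX ler_nat leq_pmulr.
Qed.

(** * Packing bound for Hölder images of the cube *)

(** Pigeonhole: the cube is cut into cells of side [1 / M]. Two points in one
    cell are at distance at most [m / M], so by the Hölder bound their images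
    are closer than [d]; hence a [d]-separated family of images has at most one
    member per cell. *)
Lemma holder_separated_card (R : realType) (m n : nat) (T : finType)
    (f : 'rV[R]_m -> 'rV[R]_n) (x : T -> 'rV[R]_m) (a H d : R) (M : nat) :
  0 <= a -> 0 <= H -> (0 < M)%N ->
  (forall u v, unit_cube u -> unit_cube v ->
    eucl_norm (f u - f v) <= H * eucl_norm (u - v) `^ a) ->
  (forall j, unit_cube (x j)) ->
  (forall j k, j != k -> d <= eucl_norm (f (x j) - f (x k))) ->
  H * (m%:R / M%:R) `^ a < d ->
  (#|T| <= M.+1 ^ m)%N.
Proof.
move=> a0 H0 M0 fH xc sep dM.
(* A coordinate equal to 1 has cell index M, hence M.+1 cells per axis. *)
pose cell (j : T) : {ffun 'I_m -> 'I_M.+1} :=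
  [ffun i => inord (Num.truncn (M%:R * x j 0 i))].
have M0' : 0 < M%:R :> R by rewrite ltr0n.
have cellE j i : (cell j i)%:R <= M%:R * x j 0 i < (cell j i).+1%:R.
  have /andP[x0 x1] := xc j i.
  have Mx0 : 0 <= M%:R * x j 0 i by rewrite mulr_ge0.
  rewrite ffunE inordK; first exact: truncn_itv.
  rewrite ltnS -(@ler_nat R); have /andP[/le_trans -> //] := truncn_itv Mx0.
  by rewrite -[leRHS]mulr1 ler_wpM2l.
suff /leq_card : injective cell by rewrite card_ffun !card_ord.
move=> j k jk; apply/eqP; apply: contraTT isT => jNk.
have le1 : eucl_norm (x j - x k) <= m%:R / M%:R.
  apply: eucl_norm_le => i; rewrite !mxE.
  have /andP[j1 j2] := cellE j i; have /andP[] := cellE k i.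
  rewrite -jk => k1 k2.
  rewrite -(ler_pM2l M0') mulfV ?gt_eqF// -{1}(ger0_norm (ltW M0')) -normrM.
  rewrite ler_norml mulrBr; rewrite -!natr1 in j2 k2; lra.
suff: eucl_norm (f (x j) - f (x k)) < d by rewrite ltNge sep.
apply: le_lt_trans (fH _ _ (xc j) (xc k)) _.
apply: le_lt_trans dM; rewrite ler_wpM2l// ge0_ler_powR ?nnegrE//.
exact: sqrtr_ge0.
Qed.

(** * The set *)

(** The points of the [k]-th grid are indexed by [j]: [2 ^ k ^ 2] equally spaced
    values on each axis, with spacing [2 ^- (k ^ 2 + k)], so that the grid has
    diameter of order [2 ^- k]. *)
Definition grid_point (R : realType) (N k : nat)
    (j : {ffun 'I_N -> 'I_(2 ^ k ^ 2)}) : 'rV[R]_N :=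
  \row_i ((j i)%:R * 2 ^- (k ^ 2 + k)).

Definition grid (R : realType) (N k : nat) : set 'rV[R]_N :=
  range (@grid_point R N k).

(** The countable compact set: a union of grids shrinking to the origin. *)
Definition grid_union (R : realType) (N : nat) : set 'rV[R]_N :=
  \bigcup_k @grid R N k.

(** Closed ball of radius [r] around the origin for the sup norm. *)
Definition box (R : realType) (N : nat) (r : R) : set 'rV[R]_N :=
  [set v | forall i, v 0 i \in `[- r, r]].

Lemma grid_finite (R : realType) (N k : nat) : finite_set (@grid R N k).
Proof. exact: finite_image. Qed.

Lemma grid_union_countable (R : realType) (N : nat) :
  countable (@grid_union R N).
Proof.
apply: bigcup_countable => // k _.
exact/finite_set_countable/grid_finite.
Qed.

Lemma grid_box (R : realType) (N k : nat) : @grid R N k `<=` box (2 ^- k).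
Proof.
move=> _ [j _ <-] i; rewrite /= in_itv/= mxE.
have p0 e : 0 < 2 ^+ e :> R by rewrite exprn_gt0.
apply/andP; split.
  by rewrite (@le_trans _ _ 0)// ?oppr_le0 ?mulr_ge0// invr_ge0 ltW.
rewrite exprD invfM mulrA ler_piMl ?invr_ge0 ?(ltW (p0 _))//.
by rewrite ler_pdivrMr// mul1r -natrX ler_nat ltnW.
Qed.

Lemma box_compact (R : realType) (N : nat) (r : R) : compact (@box R N r).
Proof.
exact: (rV_compact (fun=> @segment_compact R (- r) r)).
Qed.

Lemma box_closed (R : realType) (N : nat) (r : R) : closed (@box R N r).
Proof.
by apply: compact_closed (@box_compact _ _ _); exact: norm_hausdorff.
Qed.

Lemma box_sub (R : realType) (N : nat) (r s : R) :
  r <= s -> @box R N r `<=` box s.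
Proof.
move=> rs v vr i; have := vr i; rewrite /= !in_itv/= => /andP[v1 v2].
by rewrite (le_trans _ v1) ?lerN2// (le_trans v2).
Qed.

Lemma finite_closed_rV (R : realType) (N : nat) (A : set 'rV[R]_N) :
  finite_set A -> closed A.
Proof.
move: A; apply/accessible_finite_set_closed.
by apply: hausdorff_accessible; exact: norm_hausdorff.
Qed.

Lemma expr2N_small (R : realType) (r : R) : 0 < r -> exists k, 2 ^- k < r :> R.
Proof.
move=> r0; exists (Num.truncn r^-1).+1.
rewrite invf_plt ?posrE ?exprn_gt0//.
apply: lt_trans (truncnS_gt _) _.
by rewrite -natrX ltr_nat ltn_expl.
Qed.

(** All but finitely many points of the set lie in a given neighbourhood of the
    origin. *)
Lemma grid_union_split (R : realType) (N k : nat) :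
  @grid_union R N `<=` \bigcup_(l in `I_k) @grid R N l `|` box (2 ^- k).
Proof.
move=> v [l _ vl]; have [lk|kl] := ltnP l k; first by left; exists l.
right; apply: box_sub (grid_box vl).
by rewrite lef_pV2 ?posrE ?exprn_gt0// ler_eXn2l// ltr1n.
Qed.

(** The grid of index 0 is reduced to the origin. *)
Lemma grid_union0 (R : realType) (N : nat) : @grid_union R N 0.
Proof.
have h0 : (0 < 2 ^ 0 ^ 2)%N by rewrite expn_gt0.
exists 0%N => //; exists [ffun => Ordinal h0] => //.
by apply/rowP => i; rewrite !mxE ffunE mul0r.
Qed.

Lemma rV_neq0_notin_box (R : realType) (N : nat) (v : 'rV[R]_N) :
  v != 0 -> exists k, ~ box (2 ^- k) v.
Proof.
move=> v0; have [i vi] : exists i, v 0 i != 0.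
  apply/existsP; apply: contra_neqT v0; rewrite negb_exists => /forallP h.
  by apply/rowP => i; rewrite mxE; apply/eqP; rewrite -[_ == _]negbK h.
have [k kv] : exists k, 2 ^- k < `|v 0 i|.
  by apply: expr2N_small; rewrite normr_gt0.
exists k => /(_ i); rewrite /= in_itv/= -ler_norml => /le_lt_trans/(_ kv).
by rewrite ltxx.
Qed.

Lemma grid_union_compact (R : realType) (N : nat) : compact (@grid_union R N).
Proof.
apply: (@subclosed_compact _ _ (@box R N (2 ^- 0))); last 2 first.
- exact: box_compact.
- by move=> v /(@grid_union_split _ _ 0)[[l]|].
(* The set is an intersection of closed sets: by the splitting into finitely
   many points and a box, with the boxes shrinking to the origin. *)
have -> : @grid_union R N =
    \bigcap_k (\bigcup_(l in `I_k) @grid R N l `|` box (2 ^- k)).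
  apply/seteqP; split=> [v vE k _|v vE]; first exact: grid_union_split.
  have [->|/rV_neq0_notin_box[k kv]] := eqVneq v 0; first exact: grid_union0.
  by have [[l _ vl]|//] := vE k I; exists l.
apply: closed_bigI => k _; apply: closedU; last exact: box_closed.
apply: finite_closed_rV; apply: bigcup_finite => // l _; exact: grid_finite.
Qed.

(** The hypothesis on [N] matters: for [N = 0] the set is a single point without
    accumulation point. *)
Lemma limit_point_grid_union (R : realType) (N : nat) :
  (0 < N)%N -> limit_point (@grid_union R N) = [set 0].
Proof.
case: N => // N _; apply/seteqP; split=> [v /= vl|_ -> U].
- apply: contrapT => /eqP /rV_neq0_notin_box[k kv].
  pose A := \bigcup_(l in `I_k) @grid R N.+1 l `\ v.
  have Af : closed A.
    apply: finite_closed_rV; apply: sub_finite_set (@subDsetl _ _ _) _.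
    apply: bigcup_finite => // l _.
    exact: grid_finite.
  have nA : nbhs v (~` A).
    by apply: open_nbhs_nbhs; split; [exact: closed_openC|move=> [_ /(_ erefl)]].
  have nB : nbhs v (~` box (2 ^- k)).
    apply: open_nbhs_nbhs; split => //.
    exact/closed_openC/box_closed.
  have [y [yv yE [yA yB]]] := vl _ (filterI nA nB).
  have [yl|//] := grid_union_split k yE.
  by apply: yA; split => //= yv'; rewrite yv' eqxx in yv.
- move=> /nbhs_ballP[e /= e0 eU].
  have [k ke] := expr2N_small e0.
  have h1 : (1 < 2 ^ k.+1 ^ 2)%N by rewrite -(expn0 2) ltn_exp2l ?expn_gt0.
  have p0 l : 0 < 2 ^- l :> R by rewrite invr_gt0 exprn_gt0.
  (* The diagonal point of index 1 in grid k.+1; in grid 0 there is no index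
     1, hence the shift. *)
  pose v : 'rV[R]_N.+1 := grid_point R [ffun => Ordinal h1].
  have vE : grid k.+1 v by exists [ffun => Ordinal h1].
  exists v; split.
  + apply/eqP => /rowP /(_ ord0); rewrite !mxE ffunE mul1r => /eqP.
    by rewrite gt_eqF.
  + by exists k.+1.
  + apply: eU; split=> // r i; rewrite ord1 /ball /= mxE sub0r normrN.
    apply: le_lt_trans ke; apply: le_trans (_ : 2 ^- k.+1 <= _).
      by rewrite ler_norml; have := grid_box vE i; rewrite in_itv.
    by rewrite lef_pV2 ?posrE ?exprn_gt0// ler_eXn2l// ltr1n.
Qed.

Lemma grid_separated (R : realType) (N k : nat)
    (j l : {ffun 'I_N -> 'I_(2 ^ k ^ 2)}) : j != l ->
  2 ^- (k ^ 2 + k) <= eucl_norm (grid_point R j - grid_point R l).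
Proof.
move=> jl; have [i ji] : exists i, j i != l i.
  apply/existsP; apply: contra_neqT jl; rewrite negb_exists => /forallP h.
  by apply/ffunP => i; apply/eqP; rewrite -[_ == _]negbK h.
apply: le_trans (le_coord_eucl_norm _ i).
rewrite !mxE -mulrBl normrM [X in _ <= _ * X]ger0_norm; last first.
  by rewrite invr_ge0 exprn_ge0.
rewrite ler_peMl ?invr_ge0 ?exprn_ge0//.
rewrite -[_%:R]/(_%:Z%:~R) -[X in _ - X]/(_%:Z%:~R).
rewrite -intrB -intr_norm (ler_int R 1) -gtz0_ge1 normr_gt0 subr_eq0.
by apply: contraNneq ji => /eqP; rewrite eqz_nat => /eqP/val_inj->.
Qed.

(** * Hölder images of the cube miss the set *)

(** The exponent count: [k ^+ 2 * (n - s * m)] is at most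
    [2 * s * k * m + 2 * m], which is linear in [k]; the second hypothesis
    expresses that [k] is too large for that. *)
Lemma exponent_contradiction (R : realFieldType) (k q m n s : R) :
  m <= k * m ->
  k * (2 * s * m + 2 * m) < k * (k * (n - s * m)) ->
  q * m <= (s * (k ^+ 2 + 2 * k) + 1) * m ->
  k ^+ 2 * n <= (q + 1) * m -> False.
Proof. by move=> *; lra. Qed.

(** With [M = 2 ^ q] and [q] just above [s * (k ^ 2 + 2 * k)], points at
    distance at most [m / M] have images at distance less than the spacing of
    the [k]-th grid as soon as [2 ^+ k] exceeds the constants. The packing bound
    then gives [k ^ 2 * N <= (q + 1) * m], whose right-hand side is
    [s * m * k ^ 2 + O(k)]; this fails for large [k] because [s * m < N]. *)
Lemma grid_not_in_holder_image (R : realType) (N m : nat) (s : R)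
    (f : 'rV[R]_m -> 'rV[R]_N) :
  (0 < m)%N -> 1 <= s -> s < N%:R / m%:R ->
  holder_on (@unit_cube R m) (1 / s) f ->
  ~ (@grid_union R N `<=` f @` (@unit_cube R m)).
Proof.
move=> m0 s1 sN [H0 fH0] Ef.
have s0 : 0 < s by exact: lt_le_trans s1.
have m0' : 0 < m%:R :> R by rewrite ltr0n.
pose H := `|H0|.
have fH u v : unit_cube u -> unit_cube v ->
    eucl_norm (f u - f v) <= H * eucl_norm (u - v) `^ (1 / s).
  move=> uc vc; apply: le_trans (fH0 _ _ uc vc) _.
  by rewrite ler_wpM2r ?powR_ge0// ler_norm.
pose e := N%:R - s * m%:R.
have e0 : 0 < e by rewrite subr_gt0 -ltr_pdivlMr.
(* Beyond A the exponents are contradictory; beyond C the factor 2 ^+ k absorbs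
   the constants of the Hölder bound. *)
pose A := (2 * s * m%:R + 2 * m%:R) / e.
pose C := H * m%:R `^ (1 / s).
pose k := (Num.truncn (Num.max A C)).+1.
have [Ak Ck] : A < k%:R /\ C < k%:R.
  by apply/andP; rewrite -gt_max truncnS_gt.
have {}Ak : 2 * s * m%:R + 2 * m%:R < k%:R * e by rewrite -ltr_pdivrMr.
have {}Ck : C < 2 ^+ k.
  by apply: lt_trans Ck _; rewrite -natrX ltr_nat ltn_expl.
pose t := s * (k ^ 2 + 2 * k)%N%:R.
have t0 : 0 <= t by rewrite mulr_ge0// ltW.
pose q := (Num.truncn t).+1.
have /andP[qt tq] := truncn_itv t0; rewrite -/q in tq.
have preim (j : {ffun 'I_N -> 'I_(2 ^ k ^ 2)}) :
    exists u, unit_cube u /\ f u = grid_point R j.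
  have [|u uc fu] := Ef (grid_point R j); last by exists u.
  by exists k => //; exists j.
have [x xP] := choice preim.
have : (#|{ffun 'I_N -> 'I_(2 ^ k ^ 2)}| <= (2 ^ q).+1 ^ m)%N.
  apply: (@holder_separated_card R m N _ f x (1 / s) H (2 ^- (k ^ 2 + k))) => //.
  - by rewrite divr_ge0// ltW.
  - exact: normr_ge0.
  - by rewrite expn_gt0.
  - by move=> j; case: (xP j).
  - by move=> j l jl; rewrite (xP j).2 (xP l).2 grid_separated.
  have q0 : 0 <= (2 ^ q)%:R^-1 :> R by rewrite invr_ge0.
  rewrite powRM// mulrA -/C.
  have le1 : (2 ^ q)%:R^-1 `^ (1 / s) <= 2 ^- (k ^ 2 + 2 * k) :> R.
    have -> : 2 ^- (k ^ 2 + 2 * k) = (2^-1 `^ t) `^ (1 / s) :> R.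
      rewrite -powRrM /t mulrAC mulrA mulr1 mulfV ?gt_eqF// mul1r.
      by rewrite powR_mulrn ?invr_ge0// exprVn.
    rewrite ge0_ler_powR ?nnegrE ?powR_ge0 ?divr_ge0 ?(ltW s0)//.
    rewrite natrX -exprVn -powR_mulrn ?invr_ge0//.
    by rewrite ger_powR ?(ltW tq)// invr_gt0 ltr0n/= invf_le1 ?ler1n.
  apply: le_lt_trans (ler_wpM2l _ le1) _.
    by rewrite mulr_ge0 ?powR_ge0 ?normr_ge0.
  (* k ^ 2 + 2 * k = (k ^ 2 + k) + k: the extra k pays for C. *)
  rewrite mul2n -addnn addnA [in X in X < _]exprD invfM mulrCA gtr_pMr.
    by rewrite ltr_pdivrMr ?exprn_gt0// mul1r.
  by rewrite invr_gt0 exprn_gt0.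
rewrite card_ffun !card_ord => cle.
have : ((2 ^ k ^ 2) ^ N <= (2 ^ q.+1) ^ m)%N.
  apply: leq_trans cle _.
  rewrite leq_exp2r// expnS mul2n -addnn -addn1 leq_add2l.
  by rewrite expn_gt0.
rewrite -!expnM leq_exp2l// -(ler_nat R) (natrM _ (k ^ 2)) natrX natrM -natr1.
have {}qt : (Num.truncn t)%:R <= s * (k%:R ^+ 2 + 2 * k%:R).
  by apply: le_trans qt _; rewrite /t natrD natrX natrM.
have {qt} : q%:R * m%:R <= (s * (k%:R ^+ 2 + 2 * k%:R) + 1) * m%:R.
  by rewrite ler_pM2r// /q -natr1 lerD2r.
have : k%:R * (2 * s * m%:R + 2 * m%:R) < k%:R * (k%:R * e).
  by rewrite ltr_pM2l// ltr0n.
have : m%:R <= k%:R * m%:R :> R by rewrite ler_peMl ?(ltW m0')// ler1n.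
exact: exponent_contradiction.
Qed.

Theorem proposition9p6 (R : realType) (N : nat) (hN : (2 <= N)%N) :
  exists E : set 'rV[R]_N,
    [/\ compact E,
        countable E,
        exists p : 'rV[R]_N, limit_point E = [set p]
      & forall (m : nat) (s : R),
          (1 <= m <= N - 1)%N -> 1 <= s -> s < N%:R / m%:R ->
          ~ (exists f : 'rV[R]_m -> 'rV[R]_N,
               holder_on (@unit_cube R m) (1 / s) f /\
               E `<=` f @` (@unit_cube R m))].
Proof.
exists (@grid_union R N); split.
- exact: grid_union_compact.
- exact: grid_union_countable.
- by exists 0; apply: limit_point_grid_union; exact: ltnW.
- move=> m s /andP[m0 _] s1 sN [f [fH]].
  exact: grid_not_in_holder_image fH.
Qed.
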